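(* Let $1\le n\le N-1$ and let $\mathbf E^n,\mathbf H^n$ be the solution of the ADI-FDTD scheme with the discrete PEC boundary condition (both defined in the context). Then $$\begin{aligned}&\|\delta_t\mathbf E^{n+\frac12}\|_E^2+\|\delta_t\mathbf H^{n+\frac12}\|_H^2+\frac{(\Delta t)^2}{4\mu\varepsilon}\Big(\|\delta_2^h\delta_t\mathbf H^{n+\frac12}\|_E^2+\|\delta_1^h\delta_t\mathbf E^{n+\frac12}\|_H^2\Big)\\&\quad=\|\delta_t\mathbf E^{n-\frac12}\|_E^2+\|\delta_t\mathbf H^{n-\frac12}\|_H^2+\frac{(\Delta t)^2}{4\mu\varepsilon}\Big(\|\delta_2^h\delta_t\mathbf H^{n-\frac12}\|_E^2+\|\delta_1^h\delta_t\mathbf E^{n-\frac12}\|_H^2\Big).\end{aligned}$$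
   Context: **Grid.** $\varepsilon,\mu>0$ are constants; $I,J,K\ge2$ and $N\ge1$ are integers; $\Delta x=1/I$, $\Delta y=1/J$, $\Delta z=1/K$, $T>0$, $\Delta t=T/N$; $\Delta v=\Delta x\Delta y\Delta z$; $\bar l:=l+\tfrac12$ for $l=i,j,k,n$. A grid function carries spatial indices $(\alpha,\beta,\gamma)$ (integers or half-integers), referring to the point $(\alpha\Delta x,\beta\Delta y,\gamma\Delta z)$ of the unit cube, and a time index $m$ for time $m\Delta t$. ''$F|_{\alpha,\beta,\gamma}$'' means that all terms of $F$ are evaluated at spatial index $(\alpha,\beta,\gamma)$. The components live on staggered grids: $E_x$ at $(\bar i,j,k)$, $E_y$ at $(i,\bar j,k)$, $E_z$ at $(i,j,\bar k)$ (E-points); $H_x$ at $(i,\bar j,\bar k)$, $H_y$ at $(\bar i,j,\bar k)$, $H_z$ at $(\bar i,\bar j,k)$ (H-points). Here an integer $x$-index runs over $0,\dots,I$ and a half-integer one over $\tfrac12,\dots,I-\tfrac12$, similarly for $y$ (with $J$) and $z$ (with $K$). **Difference operators.** $\delta_xU_{\alpha,\beta,\gamma}=(U_{\alpha+\frac12,\beta,\gamma}-U_{\alpha-\frac12,\beta,\gamma})/\Delta x$, and $\delta_y,\delta_z$ analogously; $\delta_tU^{m}=(U^{m+\frac12}-U^{m-\frac12})/\Delta t$, so $\delta_t\mathbf E^{n+\frac12}=(\mathbf E^{n+1}-\mathbf E^n)/\Delta t$. For vector grid functions $\delta_1^h\mathbf U=(\delta_yU_z,\delta_zU_x,\delta_xU_y)$,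 $\delta_2^h\mathbf U=(\delta_zU_y,\delta_xU_z,\delta_yU_x)$. Thus the components of $\delta_1^h\mathbf E$ live at H-points and those of $\delta_2^h\mathbf H$ at (interior) E-points. **ADI-FDTD scheme.** Given $\mathbf E^n,\mathbf H^n$, the fields $\mathbf E^{\bar n},\mathbf H^{\bar n}$ and $\mathbf E^{n+1},\mathbf H^{n+1}$ satisfy, for every $0\le n\le N-1$: Stage 1: $\frac{E_x^{\bar n}-E_x^n}{\Delta t}=\frac1{2\varepsilon}(\delta_yH_z^{\bar n}-\delta_zH_y^n)|_{\bar i,j,k}$, $\frac{E_y^{\bar n}-E_y^n}{\Delta t}=\frac1{2\varepsilon}(\delta_zH_x^{\bar n}-\delta_xH_z^n)|_{i,\bar j,k}$, $\frac{E_z^{\bar n}-E_z^n}{\Delta t}=\frac1{2\varepsilon}(\delta_xH_y^{\bar n}-\delta_yH_x^n)|_{i,j,\bar k}$, $\frac{H_x^{\bar n}-H_x^n}{\Delta t}=\frac1{2\mu}(\delta_zE_y^{\bar n}-\delta_yE_z^n)|_{i,\bar j,\bar k}$, $\frac{H_y^{\bar n}-H_y^n}{\Delta t}=\frac1{2\mu}(\delta_xE_z^{\bar n}-\delta_zE_x^n)|_{\bar i,j,\bar k}$, $\frac{H_z^{\bar n}-H_z^n}{\Delta t}=\frac1{2\mu}(\delta_yE_x^{\bar n}-\delta_xE_y^n)|_{\bar i,\bar j,k}$. Stage 2: $\frac{E_x^{n+1}-E_x^{\bar n}}{\Delta t}=\frac1{2\varepsilon}(\delta_yH_z^{\bar n}-\delta_zH_y^{n+1})|_{\bar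 i,j,k}$, $\frac{E_y^{n+1}-E_y^{\bar n}}{\Delta t}=\frac1{2\varepsilon}(\delta_zH_x^{\bar n}-\delta_xH_z^{n+1})|_{i,\bar j,k}$, $\frac{E_z^{n+1}-E_z^{\bar n}}{\Delta t}=\frac1{2\varepsilon}(\delta_xH_y^{\bar n}-\delta_yH_x^{n+1})|_{i,j,\bar k}$, $\frac{H_x^{n+1}-H_x^{\bar n}}{\Delta t}=\frac1{2\mu}(\delta_zE_y^{\bar n}-\delta_yE_z^{n+1})|_{i,\bar j,\bar k}$, $\frac{H_y^{n+1}-H_y^{\bar n}}{\Delta t}=\frac1{2\mu}(\delta_xE_z^{\bar n}-\delta_zE_x^{n+1})|_{\bar i,j,\bar k}$, $\frac{H_z^{n+1}-H_z^{\bar n}}{\Delta t}=\frac1{2\mu}(\delta_yE_x^{\bar n}-\delta_xE_y^{n+1})|_{\bar i,\bar j,k}$. The $\mathbf E$-equations hold at the E-points not lying on a face where that component is tangential (i.e. its integer indices are strictly between the endpoints); the $\mathbf H$-equations hold at all H-points. *Discrete PEC boundary condition*, for all integer and half-integer time levels $m$: $E_x^m=0$ if its $y$-index is $0$ or $J$ or its $z$-index is $0$ or $K$; $E_y^m=0$ if its $x$-index is $0$ or $I$ or its $z$-index is $0$ or $K$; $E_z^m=0$ if its $x$-index is $0$ or $I$ or its $y$-index is $0$ or $J$. **Norms.** The weight $P(\cdot)$ equals $\varepsilon$ for grid functions obtained from the electric field ($\delta_t\mathbf E$, $\delta_1^h\delta_t\mathbf E$) and $\mu$ for those obtained from the magnetic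 field ($\delta_t\mathbf H$, $\delta_2^h\delta_t\mathbf H$). For $\mathbf U$ on E-points and $\mathbf V$ on H-points, $$\|\mathbf U\|_E^2=\Delta v\,P(\mathbf U)\Big[\sum_{i=0}^{I-1}\sum_{j=1}^{J-1}\sum_{k=1}^{K-1}U_x^2|_{\bar i,j,k}+\sum_{i=1}^{I-1}\sum_{j=0}^{J-1}\sum_{k=1}^{K-1}U_y^2|_{i,\bar j,k}+\sum_{i=1}^{I-1}\sum_{j=1}^{J-1}\sum_{k=0}^{K-1}U_z^2|_{i,j,\bar k}\Big],$$ $$\|\mathbf V\|_H^2=\Delta v\,P(\mathbf V)\Big[\sum_{i=0}^{I}\sum_{j=0}^{J-1}\sum_{k=0}^{K-1}V_x^2|_{i,\bar j,\bar k}+\sum_{i=0}^{I-1}\sum_{j=0}^{J}\sum_{k=0}^{K-1}V_y^2|_{\bar i,j,\bar k}+\sum_{i=0}^{I-1}\sum_{j=0}^{J-1}\sum_{k=0}^{K}V_z^2|_{\bar i,\bar j,k}\Big].$$ *)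

(* Defs.v *)
From HB Require Import structures.
From mathcomp Require Import all_boot all_order all_algebra.
From mathcomp Require Import reals.

Set Implicit Arguments.
Unset Strict Implicit.
Unset Printing Implicit Defensive.

Import Order.TTheory GRing.Theory Num.Theory.
Local Open Scope ring_scope.

(* Spatial and temporal indices are stored doubled: the int [a] stands for the
   integer or half-integer index a/2, so [node l] is the index l and [mid l] is
   the index l + 1/2.  A grid function is total; only its values at the points
   of the staggered grid of the component it represents are meaningful. *)
Definition node (l : nat) : int := (2 * l)%N%:Z.
Definition mid (l : nat) : int := (2 * l + 1)%N%:Z.

Definition grid (R : realType) : Type := int -> int -> int -> R.

Record vgrid (R : realType) : Type :=
  VGrid { xc : grid R; yc : grid R; zc : grid R }.

Definition step (R : realType) (L : nat) : R := 1 / L%:R.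

Definition delta_x (R : realType) (I : nat) (U : grid R) : grid R :=
  fun a b c => (U (a + 1) b c - U (a - 1) b c) / step R I.

Definition delta_y (R : realType) (J : nat) (U : grid R) : grid R :=
  fun a b c => (U a (b + 1) c - U a (b - 1) c) / step R J.

Definition delta_z (R : realType) (K : nat) (U : grid R) : grid R :=
  fun a b c => (U a b (c + 1) - U a b (c - 1)) / step R K.

Definition delta_t (R : realType) (dt : R) (F : int -> vgrid R) (m : int) :
    vgrid R :=
  VGrid (fun a b c => (xc (F (m + 1)) a b c - xc (F (m - 1)) a b c) / dt)
        (fun a b c => (yc (F (m + 1)) a b c - yc (F (m - 1)) a b c) / dt)
        (fun a b c => (zc (F (m + 1)) a b c - zc (F (m - 1)) a b c) / dt).

Definition delta1 (R : realType) (I J K : nat) (U : vgrid R) : vgrid R :=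
  VGrid (delta_y J (zc U)) (delta_z K (xc U)) (delta_x I (yc U)).

Definition delta2 (R : realType) (I J K : nat) (U : vgrid R) : vgrid R :=
  VGrid (delta_z K (yc U)) (delta_x I (zc U)) (delta_y J (xc U)).

(* The electric updates of both stages have the shape
   (E1 - E0) / dt = (1 / (2 eps)) (delta1 Ha - delta2 Hb); they are imposed at
   the E-points off the faces where the component is tangential. *)
Definition E_update (R : realType) (eps dt : R) (I J K : nat)
    (E1 E0 Ha Hb : vgrid R) : Prop :=
  [/\ forall i j k : nat, (i < I)%N -> (0 < j < J)%N -> (0 < k < K)%N ->
        (xc E1 (mid i) (node j) (node k) - xc E0 (mid i) (node j) (node k)) / dt
        = 1 / (2 * eps) * (delta_y J (zc Ha) (mid i) (node j) (node k)
                           - delta_z K (yc Hb) (mid i) (node j) (node k)),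
      forall i j k : nat, (0 < i < I)%N -> (j < J)%N -> (0 < k < K)%N ->
        (yc E1 (node i) (mid j) (node k) - yc E0 (node i) (mid j) (node k)) / dt
        = 1 / (2 * eps) * (delta_z K (xc Ha) (node i) (mid j) (node k)
                           - delta_x I (zc Hb) (node i) (mid j) (node k))
    & forall i j k : nat, (0 < i < I)%N -> (0 < j < J)%N -> (k < K)%N ->
        (zc E1 (node i) (node j) (mid k) - zc E0 (node i) (node j) (mid k)) / dt
        = 1 / (2 * eps) * (delta_x I (yc Ha) (node i) (node j) (mid k)
                           - delta_y J (xc Hb) (node i) (node j) (mid k))].

(* Likewise (H1 - H0) / dt = (1 / (2 mu)) (delta2 Ea - delta1 Eb), imposed at
   all H-points. *)
Definition H_update (R : realType) (mu dt : R) (I J K : nat)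
    (H1 H0 Ea Eb : vgrid R) : Prop :=
  [/\ forall i j k : nat, (i <= I)%N -> (j < J)%N -> (k < K)%N ->
        (xc H1 (node i) (mid j) (mid k) - xc H0 (node i) (mid j) (mid k)) / dt
        = 1 / (2 * mu) * (delta_z K (yc Ea) (node i) (mid j) (mid k)
                          - delta_y J (zc Eb) (node i) (mid j) (mid k)),
      forall i j k : nat, (i < I)%N -> (j <= J)%N -> (k < K)%N ->
        (yc H1 (mid i) (node j) (mid k) - yc H0 (mid i) (node j) (mid k)) / dt
        = 1 / (2 * mu) * (delta_x I (zc Ea) (mid i) (node j) (mid k)
                          - delta_z K (xc Eb) (mid i) (node j) (mid k))
    & forall i j k : nat, (i < I)%N -> (j < J)%N -> (k <= K)%N ->
        (zc H1 (mid i) (mid j) (node k) - zc H0 (mid i) (mid j) (node k)) / dt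
        = 1 / (2 * mu) * (delta_y J (xc Ea) (mid i) (mid j) (node k)
                          - delta_x I (yc Eb) (mid i) (mid j) (node k))].

Definition adi_stage1 (R : realType) (eps mu dt : R) (I J K : nat)
    (E H : int -> vgrid R) (n : nat) : Prop :=
  E_update eps dt I J K (E (mid n)) (E (node n)) (H (mid n)) (H (node n)) /\
  H_update mu dt I J K (H (mid n)) (H (node n)) (E (mid n)) (E (node n)).

Definition adi_stage2 (R : realType) (eps mu dt : R) (I J K : nat)
    (E H : int -> vgrid R) (n : nat) : Prop :=
  E_update eps dt I J K
    (E (node n.+1)) (E (mid n)) (H (mid n)) (H (node n.+1)) /\
  H_update mu dt I J K
    (H (node n.+1)) (H (mid n)) (E (mid n)) (E (node n.+1)).

Definition pec (R : realType) (I J K : nat) (E : vgrid R) : Prop :=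
  [/\ forall i j k : nat, (i < I)%N -> (j <= J)%N -> (k <= K)%N ->
        [\/ j = 0%N, j = J, k = 0%N | k = K] ->
        xc E (mid i) (node j) (node k) = 0,
      forall i j k : nat, (i <= I)%N -> (j < J)%N -> (k <= K)%N ->
        [\/ i = 0%N, i = I, k = 0%N | k = K] ->
        yc E (node i) (mid j) (node k) = 0
    & forall i j k : nat, (i <= I)%N -> (j <= J)%N -> (k < K)%N ->
        [\/ i = 0%N, i = I, j = 0%N | j = J] ->
        zc E (node i) (node j) (mid k) = 0].

Definition adi_solution (R : realType) (eps mu dt : R) (I J K N : nat)
    (E H : int -> vgrid R) : Prop :=
  (forall n : nat, (n < N)%N ->
     adi_stage1 eps mu dt I J K E H n /\ adi_stage2 eps mu dt I J K E H n) /\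
  (forall m : int, node 0 <= m <= node N -> pec I J K (E m)).

(* Squares of the two norms; [P] is the weight, to be taken as eps for fields
   obtained from E and mu for fields obtained from H. *)
Definition sqnormE (R : realType) (I J K : nat) (P : R) (U : vgrid R) : R :=
  step R I * step R J * step R K * P *
  (\sum_(0 <= i < I) \sum_(1 <= j < J) \sum_(1 <= k < K)
      xc U (mid i) (node j) (node k) ^+ 2
   + \sum_(1 <= i < I) \sum_(0 <= j < J) \sum_(1 <= k < K)
      yc U (node i) (mid j) (node k) ^+ 2
   + \sum_(1 <= i < I) \sum_(1 <= j < J) \sum_(0 <= k < K)
      zc U (node i) (node j) (mid k) ^+ 2).

Definition sqnormH (R : realType) (I J K : nat) (P : R) (V : vgrid R) : R :=
  step R I * step R J * step R K * P *
  (\sum_(0 <= i < I.+1) \sum_(0 <= j < J) \sum_(0 <= k < K)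
      xc V (node i) (mid j) (mid k) ^+ 2
   + \sum_(0 <= i < I) \sum_(0 <= j < J.+1) \sum_(0 <= k < K)
      yc V (mid i) (node j) (mid k) ^+ 2
   + \sum_(0 <= i < I) \sum_(0 <= j < J) \sum_(0 <= k < K.+1)
      zc V (mid i) (mid j) (node k) ^+ 2).

(* Main.v *)
Require Import Defs.
From mathcomp Require Import all_boot all_order all_algebra.
From mathcomp Require Import reals.
From mathcomp Require Import ring.
Import Order.TTheory GRing.Theory Num.Theory.
Local Open Scope ring_scope.

(** Let [a = dt / (2 * eps)] and [b = dt / (2 * mu)], and let [D1], [D2] stand
    for [delta1], [delta2].  The first stage, from [(E0, H0)] to [(E1, H1)],
    separates the two ends of the step:

      [E1 - a D1 H1 = E0 - a D2 H0]   and   [H1 - b D2 E1 = H0 - b D1 E0].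

    Take squared norms, with weights [eps] and [mu], and add.  Each side then
    carries one cross term, a multiple of [<E1, D1 H1> + <H1, D2 E1>] on the
    left and of [<E0, D2 H0> + <H0, D1 E0>] on the right, with a common factor
    because [eps * a = mu * b].  Summation by parts shows that, on fields [E]
    subject to the boundary condition, [D1] and [- D2] are adjoint to each other
    ([dot_delta1], [dot_delta2]), so both cross terms vanish.  What remains,
    [half_step_energy], says that

      [eps |E0|^2 + mu |H0|^2 + eps a^2 |D2 H0|^2 + mu b^2 |D1 E0|^2]

    equals the same expression at the half step with [D1] and [D2] exchanged.

    The second stage is the first one run backwards, with [- dt] in place of
    [dt] and starting from its final state; since the energy depends on [dt]
    only through its square, it returns to the original form at the end of the
    full step.  Finally the scheme and the boundary condition are linear with
    coefficients independent of time, so they are satisfied by the difference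
    quotients of two consecutive steps ([E_update_diffq], [H_update_diffq],
    [pec_diffq]); the theorem is the energy identity for these quotients. *)

(** * Index arithmetic and triple sums *)

Lemma node_addr1 l : node l + 1 = mid l.
Proof. by rewrite /node /mid PoszD. Qed.

Lemma mid_subr1 l : mid l - 1 = node l.
Proof. by rewrite -node_addr1 addrK. Qed.

Lemma mid_addr1 l : mid l + 1 = node l.+1.
Proof. by rewrite /node /mid -PoszD -addnA mulnS addnC. Qed.

Lemma node_succ_subr1 l : node l.+1 - 1 = mid l.
Proof. by rewrite -mid_addr1 addrK. Qed.

Definition sum3 {R : realType} (r s t : seq nat) (F : nat -> nat -> nat -> R) :=
  \sum_(i <- r) \sum_(j <- s) \sum_(k <- t) F i j k.

Lemma sum3_swap12 {R : realType} r s t (F : nat -> nat -> nat -> R) :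
  sum3 r s t F = sum3 s r t (fun j i k => F i j k).
Proof. exact: exchange_big. Qed.

Lemma sum3_swap23 {R : realType} r s t (F : nat -> nat -> nat -> R) :
  sum3 r s t F = sum3 r t s (fun i k j => F i j k).
Proof. by apply: eq_bigr => i _; exact: exchange_big. Qed.

Lemma eq_sum3 {R : realType} a b c I J K (F G : nat -> nat -> nat -> R) :
  (forall i j k, (a <= i < I)%N -> (b <= j < J)%N -> (c <= k < K)%N ->
     F i j k = G i j k) ->
  sum3 (index_iota a I) (index_iota b J) (index_iota c K) F =
  sum3 (index_iota a I) (index_iota b J) (index_iota c K) G.
Proof.
move=> FG; apply: eq_big_nat => i hi; apply: eq_big_nat => j hj.
by apply: eq_big_nat => k hk; exact: FG.
Qed.

Lemma sum3_lin {R : realType} r s t (c : R) (F G : nat -> nat -> nat -> R) :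
  sum3 r s t (fun i j k => F i j k + c * G i j k)
  = sum3 r s t F + c * sum3 r s t G.
Proof.
rewrite /sum3 mulr_sumr -big_split; apply: eq_bigr => i _ /=.
rewrite mulr_sumr -big_split; apply: eq_bigr => j _ /=.
by rewrite mulr_sumr -big_split.
Qed.

Lemma sum3_sqrD {R : realType} r s t (c : R) (F G : nat -> nat -> nat -> R) :
  sum3 r s t (fun i j k => (F i j k + c * G i j k) * (F i j k + c * G i j k))
  = sum3 r s t (fun i j k => F i j k * F i j k)
    + 2 * c * sum3 r s t (fun i j k => F i j k * G i j k)
    + c ^+ 2 * sum3 r s t (fun i j k => G i j k * G i j k).
Proof.
rewrite -!sum3_lin; apply: eq_bigr => i _; apply: eq_bigr => j _.
by apply: eq_bigr => k _; ring.
Qed.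

(** * Summation by parts *)

(** Adding the two sums, the terms telescope to boundary values of [u * v],
    which the vanishing of [u] at both ends removes. *)
Lemma sbp {R : realType} (D : nat) (h : R) (u v : int -> R) :
  u (node 0) = 0 -> u (node D) = 0 ->
  \sum_(1 <= d < D) u (node d) * ((v (node d + 1) - v (node d - 1)) / h)
  = - \sum_(0 <= d < D) v (mid d) * ((u (mid d + 1) - u (mid d - 1)) / h).
Proof.
case: D => [|D] u0 uD; first by rewrite !big_geq ?oppr0.
suff: \sum_(1 <= d < D.+1) u (node d) * ((v (node d + 1) - v (node d - 1)) / h)
    + \sum_(0 <= d < D.+1) v (mid d) * ((u (mid d + 1) - u (mid d - 1)) / h)
    = (u (node D.+1) * v (mid D) - u (node 0) * v (mid 0)) / h.
  by rewrite u0 uD !mul0r subr0 mul0r => /eqP; rewrite addr_eq0 => /eqP.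
(* With both sums on the same side the identity needs no boundary hypothesis
   and can be proved by induction on D. *)
elim: D {uD} => [|D IH].
  by rewrite big_geq // big_nat1 mid_addr1 mid_subr1; ring.
rewrite (big_nat_recr D.+1) //= (big_nat_recr D.+1 0) //=.
rewrite addrACA IH node_addr1 node_succ_subr1 mid_addr1 mid_subr1; ring.
Qed.

Lemma sum_vanish_ends {R : realType} (W : nat) (G : nat -> R) :
  G 0%N = 0 -> G W = 0 ->
  \sum_(0 <= w < W.+1) G w = \sum_(1 <= w < W) G w.
Proof.
case: W => [|W] G0 GW; first by rewrite big_nat1 big_geq.
by rewrite big_ltn // G0 add0r big_nat_recr //= GW addr0.
Qed.

(** Each term of the discrete curls pairs one component of the electric field
    with one of the magnetic field.  The three axes then play different roles:
    the difference is taken along the second one ([d]); along the third one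
    ([w]) the electric component is also tangential to the walls, and its
    vanishing there reconciles the interior range of the E-points with the full
    range of the H-points; the first one ([f]) is a mere parameter.  The six
    pairings arise by permuting the axes. *)
Lemma sbp3 {R : realType} (F D W : nat) (h : R) (U V : grid R) :
  (forall f d w : nat, (f < F)%N -> (d <= D)%N -> (w <= W)%N ->
     [\/ d = 0%N, d = D, w = 0%N | w = W] ->
     U (mid f) (node d) (node w) = 0) ->
  sum3 (index_iota 0 F) (index_iota 1 D) (index_iota 1 W)
    (fun f d w => U (mid f) (node d) (node w)
       * ((V (mid f) (node d + 1) (node w)
           - V (mid f) (node d - 1) (node w)) / h))
  = - sum3 (index_iota 0 F) (index_iota 0 D) (index_iota 0 W.+1)
    (fun f d w => V (mid f) (mid d) (node w)
       * ((U (mid f) (mid d + 1) (node w)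
           - U (mid f) (mid d - 1) (node w)) / h)).
Proof.
move=> U0; rewrite /sum3 -sumrN; apply: eq_big_nat => f /andP[_ hf].
rewrite exchange_big [in RHS]exchange_big /= sum_vanish_ends.
- rewrite -sumrN; apply: eq_big_nat => w /andP[_ hw].
  apply: (@sbp R D h (fun b => U (mid f) b (node w))
                     (fun b => V (mid f) b (node w))).
  + by apply: U0 => //; [exact: ltnW | constructor 1].
  + by apply: U0 => //; [exact: ltnW | constructor 2].
- apply: big1_seq => d /andP[_]; rewrite mem_index_iota => /andP[_ hd].
  rewrite mid_addr1 mid_subr1 !U0 ?subrr ?mul0r ?mulr0 //; first exact: ltnW.
  + by constructor 3.
  + by constructor 3.
- apply: big1_seq => d /andP[_]; rewrite mem_index_iota => /andP[_ hd].
  rewrite mid_addr1 mid_subr1 !U0 ?subrr ?mul0r ?mulr0 //; first exact: ltnW.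
  + by constructor 4.
  + by constructor 4.
Qed.

(** * The discrete curls are skew-adjoint to each other *)

Definition dotE {R : realType} (I J K : nat) (U V : vgrid R) : R :=
  sum3 (index_iota 0 I) (index_iota 1 J) (index_iota 1 K) (fun i j k =>
    xc U (mid i) (node j) (node k) * xc V (mid i) (node j) (node k))
  + sum3 (index_iota 1 I) (index_iota 0 J) (index_iota 1 K) (fun i j k =>
    yc U (node i) (mid j) (node k) * yc V (node i) (mid j) (node k))
  + sum3 (index_iota 1 I) (index_iota 1 J) (index_iota 0 K) (fun i j k =>
    zc U (node i) (node j) (mid k) * zc V (node i) (node j) (mid k)).

Definition dotH {R : realType} (I J K : nat) (U V : vgrid R) : R :=
  sum3 (index_iota 0 I.+1) (index_iota 0 J) (index_iota 0 K) (fun i j k =>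
    xc U (node i) (mid j) (mid k) * xc V (node i) (mid j) (mid k))
  + sum3 (index_iota 0 I) (index_iota 0 J.+1) (index_iota 0 K) (fun i j k =>
    yc U (mid i) (node j) (mid k) * yc V (mid i) (node j) (mid k))
  + sum3 (index_iota 0 I) (index_iota 0 J) (index_iota 0 K.+1) (fun i j k =>
    zc U (mid i) (mid j) (node k) * zc V (mid i) (mid j) (node k)).

Lemma sqnormE_dot {R : realType} (I J K : nat) (P : R) (U : vgrid R) :
  sqnormE I J K P U = step R I * step R J * step R K * P * dotE I J K U U.
Proof. by []. Qed.

Lemma sqnormH_dot {R : realType} (I J K : nat) (P : R) (U : vgrid R) :
  sqnormH I J K P U = step R I * step R J * step R K * P * dotH I J K U U.
Proof. by []. Qed.

(** Componentwise, [<Ex, dy Hz>], [<Ey, dz Hx>] and [<Ez, dx Hy>] turn into the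
    third, first and second terms of [- <H, delta2 E>], which accounts for the
    cyclic rearrangement of the sums. *)
Lemma dot_delta1 {R : realType} {I J K : nat} {E : vgrid R} (H : vgrid R) :
  pec I J K E ->
  dotE I J K E (delta1 I J K H) = - dotH I J K H (delta2 I J K E).
Proof.
move=> [Ex0 Ey0 Ez0]; rewrite /dotE /dotH !opprD.
rewrite [RHS]addrC addrA.
congr (_ + _ + _).
- exact: (@sbp3 R I J K (step R J) (xc E) (zc H)).
- rewrite [LHS]sum3_swap12 [LHS]sum3_swap23.
  rewrite [in RHS]sum3_swap12 [in RHS]sum3_swap23.
  apply: (@sbp3 R J K I (step R K) (fun b c a => yc E a b c)
                                   (fun b c a => xc H a b c)).
  move=> j k i hj hk hi b; apply: Ey0 => //.
  by case: b => ->; [constructor 3|constructor 4|constructor 1|constructor 2].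
- rewrite [LHS]sum3_swap23 [LHS]sum3_swap12.
  rewrite [in RHS]sum3_swap23 [in RHS]sum3_swap12.
  apply: (@sbp3 R K I J (step R I) (fun c a b => zc E a b c)
                                   (fun c a b => yc H a b c)).
  by move=> k i j hk hi hj b; apply: Ez0.
Qed.

Lemma dot_delta2 {R : realType} {I J K : nat} {E : vgrid R} (H : vgrid R) :
  pec I J K E ->
  dotE I J K E (delta2 I J K H) = - dotH I J K H (delta1 I J K E).
Proof.
move=> [Ex0 Ey0 Ez0]; rewrite /dotE /dotH !opprD.
rewrite -[RHS]addrA [RHS]addrC.
congr (_ + _ + _).
- rewrite [LHS]sum3_swap23 [in RHS]sum3_swap23.
  apply: (@sbp3 R I K J (step R K) (fun a c b => xc E a b c)
                                   (fun a c b => yc H a b c)).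
  move=> i k j hi hk hj b; apply: Ex0 => //.
  by case: b => ->; [constructor 3|constructor 4|constructor 1|constructor 2].
- rewrite [LHS]sum3_swap12 [in RHS]sum3_swap12.
  apply: (@sbp3 R J I K (step R I) (fun b a c => yc E a b c)
                                   (fun b a c => zc H a b c)).
  by move=> j i k hj hi hk b; apply: Ey0.
- rewrite [LHS]sum3_swap23 [LHS]sum3_swap12 [LHS]sum3_swap23.
  rewrite [in RHS]sum3_swap23 [in RHS]sum3_swap12 [in RHS]sum3_swap23.
  apply: (@sbp3 R K J I (step R J) (fun c b a => zc E a b c)
                                   (fun c b a => xc H a b c)).
  move=> k j i hk hj hi b; apply: Ez0 => //.
  by case: b => ->; [constructor 3|constructor 4|constructor 1|constructor 2].
Qed.

(** * The energy balance of one stage *)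

Definition axpy {R : realType} (U : vgrid R) (c : R) (V : vgrid R) : vgrid R :=
  VGrid (fun x y z => xc U x y z + c * xc V x y z)
        (fun x y z => yc U x y z + c * yc V x y z)
        (fun x y z => zc U x y z + c * zc V x y z).

Lemma dotE_axpy {R : realType} (I J K : nat) (U V : vgrid R) (c : R) :
  dotE I J K (axpy U c V) (axpy U c V)
  = dotE I J K U U + 2 * c * dotE I J K U V + c ^+ 2 * dotE I J K V V.
Proof. rewrite /dotE /= !sum3_sqrD; ring. Qed.

Lemma dotH_axpy {R : realType} (I J K : nat) (U V : vgrid R) (c : R) :
  dotH I J K (axpy U c V) (axpy U c V)
  = dotH I J K U U + 2 * c * dotH I J K U V + c ^+ 2 * dotH I J K V V.
Proof. rewrite /dotH /= !sum3_sqrD; ring. Qed.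

(** Each end of the step gets its own side of the equation; this is the form in
    which taking squares produces cross terms that cancel. *)
Lemma update_rearrange {F : fieldType} {k dt e1 e0 p q : F} : dt != 0 ->
  (e1 - e0) / dt = 1 / (2 * k) * (p - q) ->
  e1 + - (dt / (2 * k)) * p = e0 + - (dt / (2 * k)) * q.
Proof.
move=> dt0 h; have -> : e1 = e0 + dt * ((e1 - e0) / dt) by field.
rewrite h; ring.
Qed.

Lemma E_update_dot {R : realType} {eps dt : R} {I J K : nat}
    {E1 E0 Ha Hb : vgrid R} : dt != 0 ->
  E_update eps dt I J K E1 E0 Ha Hb ->
  let U1 := axpy E1 (- (dt / (2 * eps))) (delta1 I J K Ha) in
  let U0 := axpy E0 (- (dt / (2 * eps))) (delta2 I J K Hb) in
  dotE I J K U1 U1 = dotE I J K U0 U0.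
Proof.
move=> dt0 [hx hy hz] /=; rewrite /dotE /=; congr (_ + _ + _).
- apply: eq_sum3 => i j k hi hj hk.
  by rewrite (update_rearrange dt0 (hx i j k hi hj hk)).
- apply: eq_sum3 => i j k hi hj hk.
  by rewrite (update_rearrange dt0 (hy i j k hi hj hk)).
- apply: eq_sum3 => i j k hi hj hk.
  by rewrite (update_rearrange dt0 (hz i j k hi hj hk)).
Qed.

Lemma H_update_dot {R : realType} {mu dt : R} {I J K : nat}
    {H1 H0 Ea Eb : vgrid R} : dt != 0 ->
  H_update mu dt I J K H1 H0 Ea Eb ->
  let U1 := axpy H1 (- (dt / (2 * mu))) (delta2 I J K Ea) in
  let U0 := axpy H0 (- (dt / (2 * mu))) (delta1 I J K Eb) in
  dotH I J K U1 U1 = dotH I J K U0 U0.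
Proof.
move=> dt0 [hx hy hz] /=; rewrite /dotH /=; congr (_ + _ + _).
- apply: eq_sum3 => i j k hi hj hk.
  by rewrite (update_rearrange dt0 (hx i j k hi hj hk)).
- apply: eq_sum3 => i j k hi hj hk.
  by rewrite (update_rearrange dt0 (hy i j k hi hj hk)).
- apply: eq_sum3 => i j k hi hj hk.
  by rewrite (update_rearrange dt0 (hz i j k hi hj hk)).
Qed.

(** [A] and [B] are the curls of [H] and [E]: the pair [delta2], [delta1] at
    integer time levels, and the pair [delta1], [delta2] at half-integers. *)
Definition energy {R : realType} (eps mu dt : R) (I J K : nat)
    (E H A B : vgrid R) : R :=
  eps * dotE I J K E E + mu * dotH I J K H H
  + dt ^+ 2 / (4 * eps) * dotE I J K A A
  + dt ^+ 2 / (4 * mu) * dotH I J K B B.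

(** The cross terms are [- dt * <E, A>] and [- dt * <H, B>], the weights [eps]
    and [mu] cancelling the material constants of the coefficients. *)
Lemma energy_skew {R : realType} {eps mu : R} (dt : R) {I J K : nat}
    {E H A B : vgrid R} : eps != 0 -> mu != 0 ->
  dotE I J K E A = - dotH I J K H B ->
  let U := axpy E (- (dt / (2 * eps))) A in
  let V := axpy H (- (dt / (2 * mu))) B in
  eps * dotE I J K U U + mu * dotH I J K V V = energy eps mu dt I J K E H A B.
Proof.
move=> eps0 mu0 skew /=; rewrite /energy dotE_axpy dotH_axpy skew.
by field; rewrite eps0 mu0.
Qed.

(** The hypotheses are those of the first stage; the second stage also fits
    them after time reversal. *)
Lemma half_step_energy {R : realType} {eps mu dt : R} {I J K : nat}
    {E1 E0 H1 H0 : vgrid R} : eps != 0 -> mu != 0 -> dt != 0 ->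
  pec I J K E1 -> pec I J K E0 ->
  E_update eps dt I J K E1 E0 H1 H0 ->
  H_update mu dt I J K H1 H0 E1 E0 ->
  energy eps mu dt I J K E1 H1 (delta1 I J K H1) (delta2 I J K E1)
  = energy eps mu dt I J K E0 H0 (delta2 I J K H0) (delta1 I J K E0).
Proof.
move=> eps0 mu0 dt0 pec1 pec0 hE hH.
rewrite -(energy_skew dt eps0 mu0 (dot_delta1 H1 pec1)).
rewrite -(energy_skew dt eps0 mu0 (dot_delta2 H0 pec0)).
by rewrite (E_update_dot dt0 hE) (H_update_dot dt0 hH).
Qed.

(** * Time reversal and linearity *)

(** Time reversal exchanges the two ends of the step but keeps the places of
    [Ha] and [Hb]: in the second stage [Ha] is already the half-step field, so
    the reversed stage has exactly the form of a first stage. *)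
Lemma E_update_rev {R : realType} {eps dt : R} {I J K : nat}
    {E1 E0 Ha Hb : vgrid R} :
  E_update eps dt I J K E1 E0 Ha Hb -> E_update eps (- dt) I J K E0 E1 Ha Hb.
Proof.
move=> [hx hy hz]; split=> i j k hi hj hk; rewrite invrN mulrN -mulNr opprB.
- exact: hx.
- exact: hy.
- exact: hz.
Qed.

Lemma H_update_rev {R : realType} {mu dt : R} {I J K : nat}
    {H1 H0 Ea Eb : vgrid R} :
  H_update mu dt I J K H1 H0 Ea Eb -> H_update mu (- dt) I J K H0 H1 Ea Eb.
Proof.
move=> [hx hy hz]; split=> i j k hi hj hk; rewrite invrN mulrN -mulNr opprB.
- exact: hx.
- exact: hy.
- exact: hz.
Qed.

Definition diffq {R : realType} (s : R) (U V : vgrid R) : vgrid R :=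
  VGrid (fun x y z => (xc U x y z - xc V x y z) / s)
        (fun x y z => (yc U x y z - yc V x y z) / s)
        (fun x y z => (zc U x y z - zc V x y z) / s).

Lemma update_diffq {F : fieldType} (k dt s hp hq : F)
    (e1 e0 p1 p0 q1 q0 e1' e0' p1' p0' q1' q0' : F) :
  (e1 - e0) / dt = k * ((p1 - p0) / hp - (q1 - q0) / hq) ->
  (e1' - e0') / dt = k * ((p1' - p0') / hp - (q1' - q0') / hq) ->
  ((e1 - e1') / s - (e0 - e0') / s) / dt
  = k * (((p1 - p1') / s - (p0 - p0') / s) / hp
         - ((q1 - q1') / s - (q0 - q0') / s) / hq).
Proof.
move=> h h'.
have -> : ((e1 - e1') / s - (e0 - e0') / s) / dt
          = ((e1 - e0) / dt - (e1' - e0') / dt) / s by ring.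
rewrite h h'; ring.
Qed.

Lemma E_update_diffq {R : realType} {eps dt : R} (s : R) {I J K : nat}
    {E1 E0 Ha Hb E1' E0' Ha' Hb' : vgrid R} :
  E_update eps dt I J K E1 E0 Ha Hb ->
  E_update eps dt I J K E1' E0' Ha' Hb' ->
  E_update eps dt I J K (diffq s E1 E1') (diffq s E0 E0')
    (diffq s Ha Ha') (diffq s Hb Hb').
Proof.
move=> [hx hy hz] [hx' hy' hz']; split=> i j k hi hj hk; apply: update_diffq.
- exact: hx.
- exact: hx'.
- exact: hy.
- exact: hy'.
- exact: hz.
- exact: hz'.
Qed.

Lemma H_update_diffq {R : realType} {mu dt : R} (s : R) {I J K : nat}
    {H1 H0 Ea Eb H1' H0' Ea' Eb' : vgrid R} :
  H_update mu dt I J K H1 H0 Ea Eb ->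
  H_update mu dt I J K H1' H0' Ea' Eb' ->
  H_update mu dt I J K (diffq s H1 H1') (diffq s H0 H0')
    (diffq s Ea Ea') (diffq s Eb Eb').
Proof.
move=> [hx hy hz] [hx' hy' hz']; split=> i j k hi hj hk; apply: update_diffq.
- exact: hx.
- exact: hx'.
- exact: hy.
- exact: hy'.
- exact: hz.
- exact: hz'.
Qed.

Lemma pec_diffq {R : realType} (s : R) (I J K : nat) (E E' : vgrid R) :
  pec I J K E -> pec I J K E' -> pec I J K (diffq s E E').
Proof.
move=> [hx hy hz] [hx' hy' hz']; split=> i j k hi hj hk b /=.
- by rewrite hx // hx' // subrr mul0r.
- by rewrite hy // hy' // subrr mul0r.
- by rewrite hz // hz' // subrr mul0r.
Qed.

(** * Conservation of the energy of the time differences *)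

Lemma sqnorm_energy {R : realType} (eps mu dt : R) (I J K : nat)
    (E H : vgrid R) : eps != 0 -> mu != 0 ->
  sqnormE I J K eps E + sqnormH I J K mu H
  + dt ^+ 2 / (4 * mu * eps)
    * (sqnormE I J K mu (delta2 I J K H) + sqnormH I J K eps (delta1 I J K E))
  = step R I * step R J * step R K
    * energy eps mu dt I J K E H (delta2 I J K H) (delta1 I J K E).
Proof.
move=> eps0 mu0; rewrite !sqnormE_dot !sqnormH_dot /energy.
by field; rewrite eps0 mu0.
Qed.

Theorem theorem3p5 (R : realType) (eps mu T : R) (I J K N : nat)
    (E H : int -> vgrid R) (n : nat)
    (heps : 0 < eps) (hmu : 0 < mu) (hT : 0 < T)
    (hI : (2 <= I)%N) (hJ : (2 <= J)%N) (hK : (2 <= K)%N) (hN : (1 <= N)%N)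
    (hn : (1 <= n <= N - 1)%N)
    (hsol : adi_solution eps mu (T / N%:R) I J K N E H) :
  let dt : R := T / N%:R in
  let dE := delta_t dt E in
  let dH := delta_t dt H in
  sqnormE I J K eps (dE (node n + 1)) + sqnormH I J K mu (dH (node n + 1))
  + dt ^+ 2 / (4 * mu * eps)
    * (sqnormE I J K mu (delta2 I J K (dH (node n + 1)))
       + sqnormH I J K eps (delta1 I J K (dE (node n + 1))))
  = sqnormE I J K eps (dE (node n - 1)) + sqnormH I J K mu (dH (node n - 1))
    + dt ^+ 2 / (4 * mu * eps)
      * (sqnormE I J K mu (delta2 I J K (dH (node n - 1)))
         + sqnormH I J K eps (delta1 I J K (dE (node n - 1)))).
Proof.
move=> dt dE dH.
have eps0 : eps != 0 by rewrite gt_eqF.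
have mu0 : mu != 0 by rewrite gt_eqF.
have dt0 : dt != 0.
  by rewrite mulf_neq0 ?invr_eq0 ?pnatr_eq0 -?lt0n // gt_eqF.
rewrite !sqnorm_energy //; congr (_ * _).
case: n hn => [//|m] /andP[_ hm].
have m1N : (m.+1 < N)%N by rewrite (leq_ltn_trans hm) // subn1 prednK.
have mN := ltnW m1N.
have [sol bc] := hsol.
have [[s1E s1H] [s2E s2H]] := sol m.+1 m1N.
have [[r1E r1H] [r2E r2H]] := sol m mN.
have bc_le (l : nat) : (l <= 2 * N)%N -> pec I J K (E l%:Z).
  by move=> hl; apply: bc; rewrite /node muln0 !lez_nat leq0n.
have bc_node l : (l <= N)%N -> pec I J K (E (node l)).
  by move=> hl; apply: bc_le; rewrite leq_mul2l.
have bc_mid l : (l < N)%N -> pec I J K (E (mid l)).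
  by move=> hl; apply: bc_le; rewrite addn1 ltn_mul2l.
rewrite /dE /dH /delta_t node_addr1 node_succ_subr1 mid_addr1.
rewrite !mid_subr1 mid_addr1.
rewrite -!/(diffq dt _ _).
set E0 := diffq dt (E (node m.+1)) _;
set E2 := diffq dt _ (E (node m.+1)).
pose E1 := diffq dt (E (mid m.+1)) (E (mid m)).
have pec0 : pec I J K E0 by apply: pec_diffq; apply: bc_node; rewrite // ltnW.
have pec1 : pec I J K E1 by apply: pec_diffq; apply: bc_mid.
have pec2 : pec I J K E2 by apply: pec_diffq; apply: bc_node.
have up1E := E_update_diffq dt s1E r1E.
have up1H := H_update_diffq dt s1H r1H.
have up2E := E_update_diffq dt s2E r2E.
have up2H := H_update_diffq dt s2H r2H.
(* The quotients at the half step are the common final state of the first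
   stage and of the reversed second stage. *)
rewrite -(half_step_energy eps0 mu0 dt0 pec1 pec0 up1E up1H).
have ndt0 : - dt != 0 by rewrite oppr_eq0.
have := half_step_energy eps0 mu0 ndt0 pec1 pec2
          (E_update_rev up2E) (H_update_rev up2H).
by rewrite /energy sqrrN => <-.
Qed.
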